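(* For each $d\in\{46,\,50,\,52,\,54,\,57\}$ there exists a vector $l\in E_8$ with $l^2=2d$ that is orthogonal to exactly $12$ roots of $E_8$, i.e. such that $\#\{r\in E_8\mid r^2=2,\ (r,l)=0\}=12$.
   Context: $E_8$ is the unique even unimodular positive-definite lattice of rank $8$, with bilinear form $(\,,\,)$ and $x^2=(x,x)$. Concretely, $E_8$ is the set of points $l=(l_1,\dots,l_8)\in\mathbb{R}^8$ such that either all $l_i\in\mathbb{Z}$ or all $2l_i$ are odd integers, and $\sum_i l_i\in 2\mathbb{Z}$, with the standard Euclidean inner product. A root of $E_8$ is a vector $r\in E_8$ with $r^2=2$ (there are $240$ of them; $r$ and $-r$ are counted separately). *)

(* Defs.v *)
From HB Require Import structures.
From mathcomp Require Import all_boot all_order all_algebra.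
From mathcomp Require Import all_classical all_reals.

Set Implicit Arguments.
Unset Strict Implicit.
Unset Printing Implicit Defensive.

Import Order.TTheory GRing.Theory Num.Theory.

Local Open Scope classical_set_scope.
Local Open Scope ring_scope.

Definition dot (R : realType) (n : nat) (u v : 'rV[R]_n) : R :=
  \sum_i u 0 i * v 0 i.

Definition odd_integer (R : realType) (x : R) : Prop :=
  exists k : int, x = (2 * k + 1)%:~R.

Definition even_integer (R : realType) (x : R) : Prop :=
  exists k : int, x = (2 * k)%:~R.

Definition E8 (R : realType) : set 'rV[R]_8 :=
  [set l | ((forall i, l 0 i \is a Num.int) \/
            (forall i, odd_integer (2 * l 0 i))) /\
           even_integer (\sum_i l 0 i)].

Definition E8_roots (R : realType) : set 'rV[R]_8 :=
  [set r | E8 r /\ dot r r = 2].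

(* Main.v *)
(** A vector [r] of E8 is encoded by the integer list of the coordinates of
    [2 r].  For a root these coordinates are either all in {-2, 0, 2} or all in
    {-1, 1}, so the roots orthogonal to a given vector are found by filtering
    the 3^8 + 2^8 lists of one of these two shapes. *)
Require Import Defs.
From HB Require Import structures.
From mathcomp Require Import all_boot all_order all_algebra.
From mathcomp Require Import all_classical all_reals.
From mathcomp Require Import zify ring lra.

Import Order.TTheory GRing.Theory Num.Theory.

Local Open Scope classical_set_scope.
Local Open Scope card_scope.
Local Open Scope ring_scope.

Definition half_row (R : realType) (t : seq int) : 'rV[R]_8 :=
  \row_i ((t`_i)%:~R / 2).

Definition sumz (t : seq int) : int := foldr +%R 0 t.

Definition dotz (s t : seq int) : int := sumz [seq p.1 * p.2 | p <- zip s t].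

(** Doubling turns integral coordinates into even ones and half-odd coordinates into odd ones; an
    even coordinate sum becomes a multiple of 4. *)
Definition in_E8z (t : seq int) : bool :=
  (all (fun x => 2 %| x)%Z t || all (fun x => ~~ (2 %| x)%Z) t)
  && (4 %| sumz t)%Z.

Fixpoint words (T : Type) (A : seq T) (n : nat) : seq (seq T) :=
  if n is m.+1 then [seq a :: w | a <- A, w <- words T A m] else [:: [::]].

(** Doubling multiplies inner products by 4, so the norm 2 of a root reads 8 here. *)
Definition E8z_roots : seq (seq int) :=
  [seq s <- words int [:: -2; 0; 2] 8 ++ words int [:: -1; 1] 8
  | (dotz s s == 8) && in_E8z s].

Lemma mem_words (T : eqType) (A : seq T) (n : nat) (w : seq T) :
  (w \in words T A n) = (size w == n) && all (mem A) w.
Proof.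
elim: n w => [|n IHn] [|a w] //=.
  by apply/allpairsP => -[[b v] []].
apply/allpairsP/and3P => [[[b v] /= [bA vA [-> ->]]]|[sw aA wA]].
  by move: vA; rewrite IHn => /andP[].
by exists (a, w); rewrite IHn -eqSS sw wA.
Qed.

Lemma sumzE (t : seq int) : sumz t = \sum_(i < size t) t`_i.
Proof. by rewrite /sumz foldrE (big_nth 0) big_mkord. Qed.

Lemma dotzE (s t : seq int) :
  size s = size t -> dotz s t = \sum_(i < size s) s`_i * t`_i.
Proof.
move=> st; rewrite /dotz /sumz foldrE big_map (big_nth (0, 0)) big_mkord.
rewrite size_zip -st minnn; apply: eq_bigr => i _.
by rewrite nth_zip.
Qed.

Lemma sum_half_row (R : realType) (t : seq int) :
  size t = 8%N -> \sum_i half_row R t 0 i = (sumz t)%:~R / 2.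
Proof.
move=> t8; rewrite sumzE t8 rmorph_sum mulr_suml.
by apply: eq_bigr => i _; rewrite mxE.
Qed.

Lemma dot_half_row (R : realType) (s t : seq int) :
  size s = 8%N -> size t = 8%N ->
  dot (half_row R s) (half_row R t) = (dotz s t)%:~R / 4.
Proof.
move=> s8 t8; rewrite dotzE ?s8 // rmorph_sum mulr_suml.
by apply: eq_bigr => i _; rewrite !mxE rmorphM /=; field.
Qed.

Lemma even_integer_half (R : realType) (n : int) :
  even_integer (n%:~R / 2 : R) <-> (4 %| n)%Z.
Proof.
split=> [[k nk]|/dvdzP[k ->]].
  apply/dvdzP; exists k; apply: (@intr_inj R).
  by move: nk; rewrite !rmorphM /= => nk; lra.
by exists k; rewrite !rmorphM /=; field.
Qed.

Lemma int_num_half (R : realType) (n : int) :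
  (n%:~R / 2 : R) \is a Num.int <-> (2 %| n)%Z.
Proof.
split=> [/intrP[k nk]|/dvdzP[k ->]].
  apply/dvdzP; exists k; apply: (@intr_inj R).
  by rewrite rmorphM /= -nk; field.
by have -> : (k * 2)%:~R / 2 = k%:~R :> R by rewrite rmorphM /=; field.
Qed.

Lemma odd_integer_half (R : realType) (n : int) :
  odd_integer (2 * (n%:~R / 2) : R) <-> ~~ (2 %| n)%Z.
Proof.
rewrite mulrC divfK ?pnatr_eq0 //; split=> [[k /intr_inj ->]|n2].
  by lia.
by exists (n %/ 2)%Z; congr (_%:~R); lia.
Qed.

Lemma E8_half_row (R : realType) (t : seq int) :
  size t = 8%N -> E8 (half_row R t) <-> in_E8z t.
Proof.
move=> t8; rewrite /E8 /in_E8z /= sum_half_row //.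
have allE (P : pred int) : all P t <-> (forall i : 'I_8, P t`_i).
  split=> [/all_nthP tP i|tP]; first by apply: tP; rewrite t8.
  by apply/(all_nthP 0) => i; rewrite t8 => i8; apply: (tP (Ordinal i8)).
split=> [[tE /even_integer_half ->]|/andP[tE t4]].
  rewrite andbT; apply/orP; case: tE => tE; [left|right]; apply/allE => i.
    by apply/(int_num_half R); have := tE i; rewrite mxE.
  by apply/(odd_integer_half R); have := tE i; rewrite mxE.
split; last exact/even_integer_half.
case/orP: tE => /allE tE; [left|right] => i; rewrite mxE.
  exact/int_num_half.
exact/odd_integer_half.
Qed.

Lemma half_row_surj (R : realType) (z : 'I_8 -> int) (r : 'rV[R]_8) :
  (forall i, 2 * r 0 i = (z i)%:~R) -> r = half_row R (codom z).
Proof.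
move=> rz; apply/rowP => i; rewrite mxE.
by rewrite (nth_map i) ?size_enum_ord // nth_ord_enum -rz; field.
Qed.

(** The length must be fixed: [half_row] pads a short list with the default 0 and ignores entries
    beyond the eighth. *)
Lemma half_row_inj (R : realType) :
  {in [pred t | size t == 8%N] &, injective (half_row R)}.
Proof.
move=> s t /eqP s8 /eqP t8 /rowP st.
apply: (@eq_from_nth _ 0) => [|i]; rewrite s8 ?t8 // => i8.
have := st (Ordinal i8); rewrite !mxE /= => e.
by apply: (@intr_inj R); lra.
Qed.

Lemma sqr_coord_le_dotz (s : seq int) (i : nat) :
  (i < size s)%N -> s`_i ^+ 2 <= dotz s s.
Proof.
move=> si; rewrite dotzE // (bigD1 (Ordinal si)) //= expr2.
by rewrite lerDl sumr_ge0 // => j _; rewrite -expr2 sqr_ge0.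
Qed.

(* In the odd case each of the other seven squares is at least 1. *)
Lemma sqr_odd_coord_le_dotz (s : seq int) (i : nat) :
  all (fun x => ~~ (2 %| x)%Z) s ->
  (i < size s)%N -> s`_i ^+ 2 + (size s).-1%:R <= dotz s s.
Proof.
move=> /(all_nthP 0) sodd si.
rewrite dotzE // (bigD1 (Ordinal si)) //= expr2 lerD2l.
have -> : (size s).-1%:R = \sum_(j < size s | j != Ordinal si) (1 : int).
  by rewrite sumr_const cardC1 card_ord.
apply: ler_sum => j _; have := sodd j (ltn_ord j).
by move: s`_j => x x2; have : x != 0 by [lia]; nia.
Qed.

(** This is completeness of the enumeration: norm 8 and the parity condition already force one of
    the two shapes. *)
Lemma mem_E8z_roots (s : seq int) :
  (s \in E8z_roots) = [&& size s == 8%N, dotz s s == 8 & in_E8z s].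
Proof.
rewrite mem_filter mem_cat !mem_words.
apply/andP/and3P => [[/andP[-> ->] /orP[]/andP[-> _]] //|[s8 ss sE]].
split; first by rewrite ss.
rewrite s8 /=; move/eqP: s8 => s8; move/eqP: ss => ss.
case/andP: sE => /orP[] sE _; apply/orP; [left|right]; apply/(all_nthP 0) => i si.
  (* An even [x] with [x ^+ 2 <= 8] is -2, 0 or 2. *)
  have := sqr_coord_le_dotz _ _ si; have := all_nthP 0 sE i si.
  by rewrite ss !inE; move: s`_i => x; lia || nia.
(* The other seven entries use up at least 7 of the norm 8, so [x ^+ 2 <= 1]. *)
have := sqr_odd_coord_le_dotz _ _ sE si; have := all_nthP 0 sE i si.
by rewrite ss s8 !inE; move: s`_i => x /= x2 x1; nia.
Qed.

Lemma E8_rootsP (R : realType) (r : 'rV[R]_8) :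
  E8_roots r <-> exists2 s, s \in E8z_roots & r = half_row R s.
Proof.
split=> [[rE rr]|[s]]; last first.
  rewrite mem_E8z_roots => /and3P[/eqP s8 /eqP ss sE] ->; split.
    exact/E8_half_row.
  by rewrite dot_half_row // ss; lra.
(* Both kinds of vectors of [E8] have integral doubles; the chosen integers form the encoding of
   [r]. *)
have /choice[z rz] : forall i, exists k : int, 2 * r 0 i = k%:~R.
  move=> i; case: rE => -[] /(_ i); last by case=> k ->; exists (2 * k + 1).
  by move=> /intrP[k ->] _; exists (2 * k); rewrite rmorphM.
have rE' := half_row_surj _ _ _ rz; exists (codom z) => //.
have z8 : size (codom z) = 8%N by rewrite size_codom card_ord.
rewrite mem_E8z_roots z8 /=; apply/andP; split; last first.
  by apply/(E8_half_row R); rewrite -?rE'.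
move: rr; rewrite rE' dot_half_row // => zz.
by apply/eqP/(@intr_inj R); lra.
Qed.

Lemma card_E8_roots_orthogonal (R : realType) (t : seq int) :
  size t = 8%N ->
  let S := [seq s <- E8z_roots | dotz s t == 0] in
  uniq S ->
  [set r | E8_roots r /\ dot r (half_row R t) = 0] #= `I_(size S).
Proof.
move=> t8 S uS.
have S8 s : s \in S -> size s = 8%N.
  by rewrite mem_filter mem_E8z_roots => /and4P[_ /eqP].
(* The orthogonal roots are parametrized by their positions in [S]. This map is injective because
   [S] has no repetition and [half_row] is injective on lists of length 8. *)
have -> : [set r | E8_roots r /\ dot r (half_row R t) = 0] =
    (fun i => half_row R (nth [::] S i)) @` `I_(size S).
  apply/seteqP; split=> [r [/E8_rootsP[s sE ->]]|_ [i /= iS <-]].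
    have s8 : size s = 8%N by move: sE; rewrite mem_E8z_roots => /and3P[/eqP].
    rewrite dot_half_row // => st.
    have sS : s \in S.
      rewrite mem_filter sE andbT.
      by apply/eqP/(@intr_inj R); lra.
    by exists (index s S); rewrite /= ?index_mem // nth_index.
  have := mem_nth [::] iS; rewrite mem_filter => /andP[/eqP st sE].
  split; first by apply/E8_rootsP; exists (nth [::] S i).
  by rewrite dot_half_row ?st ?mul0r //; apply/S8/mem_nth.
apply: inj_card_eq => i j; rewrite !inE /= => iS jS /half_row_inj ij.
by apply/eqP; rewrite -(nth_uniq [::] iS jS uS) ij // inE S8 ?mem_nth.
Qed.

(** All requirements on the vector are gathered in one closed boolean over the integers, independent
    of [R], so that evaluation settles each case. The value [8 * d] is four times the norm
    [2 * d]. *)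
Lemma E8_vector_orthogonal_to_roots (R : realType) (n d : nat) (t : seq int) :
  let S := [seq s <- E8z_roots | dotz s t == 0] in
  [&& size t == 8%N, in_E8z t, dotz t t == (8 * d)%:Z, uniq S & size S == n] ->
  exists l : 'rV[R]_8,
    [/\ E8 l,
        dot l l = (2 * d)%:R &
        [set r | E8_roots r /\ dot r l = 0] #= `I_n].
Proof.
move=> S /and5P[/eqP t8 tE /eqP tt uS /eqP <-]; exists (half_row R t); split.
- exact/E8_half_row.
- by rewrite dot_half_row // tt -pmulrn !natrM; field.
- exact: card_E8_roots_orthogonal.
Qed.

Theorem mainTheorem2 (R : realType) (d : nat) :
  d \in [:: 46; 50; 52; 54; 57]%N ->
  exists l : 'rV[R]_8,
    [/\ E8 l,
        dot l l = (2 * d)%:R &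
        [set r | E8_roots r /\ dot r l = 0] #= `I_12].
Proof.
(* Doubled coordinates of vectors found by computer search. *)
rewrite !inE => /or4P[|||/orP[]] /eqP ->.
- apply: (E8_vector_orthogonal_to_roots _ _ _ [:: 18; 4; 4; 2; 2; 2; 0; 0]).
  by vm_compute.
- apply: (E8_vector_orthogonal_to_roots _ _ _ [:: 18; 6; 4; 4; 2; 2; 0; 0]).
  by vm_compute.
- apply: (E8_vector_orthogonal_to_roots _ _ _ [:: 18; 6; 4; 4; 4; 2; 2; 0]).
  by vm_compute.
- apply: (E8_vector_orthogonal_to_roots _ _ _ [:: 18; 6; 6; 4; 4; 2; 0; 0]).
  by vm_compute.
(* The count can be seen by hand here: 20 exceeds the sum 16 of the other entries, so no half-odd
   root is orthogonal. The equal entries 4, 4, 4 give 6 roots, the pair 2, 2 gives 2, and the two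
   zeros give 4. *)
- apply: (E8_vector_orthogonal_to_roots _ _ _ [:: 20; 4; 4; 4; 2; 2; 0; 0]).
  by vm_compute.
Qed.
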